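(* Let $\mathbb K$ be a field of characteristic $0$, let $R=\mathbb K[x_1,\ldots,x_k]$, and let $\mathcal A=\{\ell_1,\ldots,\ell_n\}\subset R$, $n\ge 2$, be linear forms, no two proportional. Then the symmetric ideal ${\rm sym}(I_{n-2}(\mathcal A))\subset \mathbb T=R[t_{i,j}\mid 1\le i<j\le n]$ is generated by all the elements $$L_{i_1,i_2,i_3}:=c_{i_1}t_{i_2,i_3}+c_{i_2}t_{i_1,i_3}+c_{i_3}t_{i_1,i_2},$$ one for each circuit $\{i_1,i_2,i_3\}$, $1\le i_1<i_2<i_3\le n$, with 3-dependency $c_{i_1}\ell_{i_1}+c_{i_2}\ell_{i_2}+c_{i_3}\ell_{i_3}=0$, together with the elements $$A_{a,b,c}:=\ell_at_{a,b}-\ell_ct_{b,c},\qquad B_{a,b,c}:=\ell_at_{a,c}-\ell_bt_{b,c},\qquad C_{a,b,c}:=\ell_bt_{a,b}-\ell_ct_{a,c},$$ for all $1\leq a<b<c\leq n$.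
   Context: A circuit here is a set $\{i_1,i_2,i_3\}$, $1\le i_1<i_2<i_3\le n$, for which there is a 3-dependency, i.e. a relation $c_{i_1}\ell_{i_1}+c_{i_2}\ell_{i_2}+c_{i_3}\ell_{i_3}=0$ with all of $c_{i_1},c_{i_2},c_{i_3}\in\mathbb K\setminus\{0\}$ (unique up to a common nonzero scalar). $f_{i,j}:=\ell_1\cdots\ell_n/(\ell_i\ell_j)$ for $1\le i<j\le n$, and $I_{n-2}(\mathcal A)$ is the ideal of $R$ generated by all the $f_{i,j}$, that is, by all products of $n-2$ of the forms with distinct indices. $\mathbb T=R[\ldots,t_{i,j},\ldots]$, $1\le i<j\le n$, is bigraded by $\deg(x_u)=(1,0)$, $\deg(t_{i,j})=(0,1)$. The Rees ideal $\mathcal I(\mathcal A,n-2)\subset\mathbb T$ is the kernel of the $R$-algebra surjection $\mathbb T\to R[I_{n-2}(\mathcal A)t]$ (the Rees algebra), $t_{i,j}\mapsto f_{i,j}t$. The symmetric ideal ${\rm sym}(I_{n-2}(\mathcal A))$ is the ideal of $\mathbb T$ generated by the elements of $\mathcal I(\mathcal A,n-2)$ of degree $1$ in the variables $t_{i,j}$, i.e. by all $\sum_{i<j}h_{i,j}t_{i,j}$ with $h_{i,j}\in R$ and $\sum_{i<j}h_{i,j}f_{i,j}=0$. *)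

(* Defs.v *)
From mathcomp Require Import all_boot all_order all_algebra.
From mathcomp Require Import mpoly.
Set Implicit Arguments.
Unset Strict Implicit.
Unset Printing Implicit Defensive.
Import GRing.Theory.
Local Open Scope ring_scope.

Definition ideal_gen (A : comNzRingType) (S : A -> Prop) (x : A) : Prop :=
  exists2 s : seq (A * A),
    (forall p, p \in s -> S p.2) & x = \sum_(p <- s) p.1 * p.2.

(* The zero form is proportional to every form. *)
Definition proportional (K : fieldType) (k : nat) (u v : {mpoly K[k]}) : Prop :=
  exists c : K, u = c *: v \/ v = c *: u.

(* Index set of the variables t_{i,j}, i < j. *)
Notation opair n := {p : 'I_n * 'I_n | (p.1 < p.2)%N}.

Definition mkpair (n : nat) (i j : 'I_n) (hij : (i < j)%N) : opair n :=
  exist (fun p : 'I_n * 'I_n => (p.1 < p.2)%N) (i, j) hij.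

(* R[t_{i,j} | i < j] over R = K[x_1, ..., x_k]; the variables are numbered
   by enum_rank. *)
Notation Tring K k n := {mpoly {mpoly K[k]}[#|{: opair n}|]}.

Definition tvar (K : fieldType) (k n : nat) (i j : 'I_n) (hij : (i < j)%N) :
    Tring K k n :=
  'X_(enum_rank (mkpair hij)).

Section Forms.
Variables (K : fieldType) (k n : nat) (ell : 'I_n -> {mpoly K[k]}).

Local Notation R := {mpoly K[k]}.
Local Notation T := (Tring K k n).
Local Notation t := (@tvar K k n _ _).

(* f_{i,j} = l_1 ... l_n / (l_i l_j) *)
Definition prod_but (i j : 'I_n) : R :=
  \prod_(m < n | (m != i) && (m != j)) ell m.

(* The R-algebra map t_{i,j} |-> f_{i,j} 'X; the Rees algebra is its image
   in R['X], so the Rees ideal is its kernel. *)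
Definition rees_map (F : T) : {poly R} :=
  mmap polyC (fun v => let p := val (enum_val v) in prod_but p.1 p.2 *: 'X) F.

Definition rees_ideal (F : T) : Prop := rees_map F = 0.

(* Homogeneity of F : T is with respect to the variables t_{i,j} only. *)
Definition sym_ideal : T -> Prop :=
  ideal_gen (fun F : T => F \is 1.-homog /\ rees_ideal F).

Definition dependency3 (i1 i2 i3 : 'I_n) (c : 'I_n -> K) : Prop :=
  [/\ c i1 != 0, c i2 != 0, c i3 != 0
    & c i1 *: ell i1 + c i2 *: ell i2 + c i3 *: ell i3 = 0].

Definition circuit (i1 i2 i3 : 'I_n) : Prop :=
  exists c, dependency3 i1 i2 i3 c.

(* [c i1 i2 i3] is the 3-dependency chosen for the circuit {i1 < i2 < i3};
   its values on other triples are irrelevant. *)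
Inductive generator (c : 'I_n -> 'I_n -> 'I_n -> 'I_n -> K) : T -> Prop :=
| GenL (i1 i2 i3 : 'I_n) (h12 : (i1 < i2)%N) (h23 : (i2 < i3)%N)
    (h13 : (i1 < i3)%N) of circuit i1 i2 i3 :
    generator c ((c i1 i2 i3 i1)%:MP *: t h23 + (c i1 i2 i3 i2)%:MP *: t h13
                 + (c i1 i2 i3 i3)%:MP *: t h12)
| GenA (a b d : 'I_n) (hab : (a < b)%N) (hbd : (b < d)%N) :
    generator c (ell a *: t hab - ell d *: t hbd)
| GenB (a b d : 'I_n) (hab : (a < b)%N) (hbd : (b < d)%N) (had : (a < d)%N) :
    generator c (ell a *: t had - ell b *: t hbd)
| GenC (a b d : 'I_n) (hab : (a < b)%N) (hbd : (b < d)%N) (had : (a < d)%N) :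
    generator c (ell b *: t hab - ell d *: t had).

End Forms.

(* Main.v *)
Require Import Defs.
From HB Require Import structures.
From mathcomp Require Import all_boot all_order all_algebra.
From mathcomp Require Import mpoly ring.
Set Implicit Arguments.
Unset Strict Implicit.
Unset Printing Implicit Defensive.
Import GRing.Theory.
Local Open Scope ring_scope.

(** The relations come from reducing modulo one form at a time.

    Work with all the t_{i,j}, i <> j, under the convention t_{i,j} = t_{j,i}.
    The elements A, B, C are then the three instances, according to the position
    of the common index, of the single relation l_a t_{a,b} = l_d t_{d,b}, which
    holds because l_a f_{a,b} is the product of all the forms but l_b
    ([slide_mem]). Write J for the ideal generated by the L, A, B, C, and call F
    reducible to a set S of indices when, modulo J, it is an R-combination of the
    t_{i,j} with i, j in S ([span_mod]). An element of J maps to 0 in the Rees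
    algebra ([generator_rees]); conversely it is shown, by induction on S, that
    an F reducible to S and mapping to 0 lies in J ([span_mod_syzygy]). For S the
    set of all indices, these are the elements of degree 1 in the t's of the Rees
    ideal.

    Let d be in S, S' = S \ {d}. Modulo the t_{i,j} with i, j in S', F is a sum
    of u_q t_{q,d} over some Q contained in S', initially Q = S'. If a, b in Q
    and d form a circuit, the relation L replaces t_{a,d} by a multiple of
    t_{b,d}, up to a multiple of t_{a,b}; so Q may be assumed to have no such
    pair, i.e. the l_q, q in Q, are pairwise independent modulo l_d
    ([span_mod_reduce]).
    Every f_{i,j} with i, j in S' is divisible by l_d, whence
    sum_q u_q f_{q,d} = 0 modulo l_d. All f_{q,d} share the factor consisting of
    the l_m with m outside Q and m <> d, which cancels since R / l_d is a domain.
    What remains is a syzygy of the products prod_(m in Q \ q) l_m over R / l_d.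
    Only one of them is not divisible by l_q, and R / (l_d, l_q) is a domain in
    which the other l_m are nonzero; hence u_q = a_q l_q + v_q l_d, and then
    sum_q a_q = w l_d ([independent_syzygy]). The terms v_q l_d t_{q,d} become
    v_q l_b t_{b,q} for some b in S', the terms a_q l_q t_{q,d} all move to one
    q0, and their sum w l_d l_{q0} t_{q0,d} is absorbed in the same way. Thus F is
    reducible to S'. This needs a b in S' other than q; when S' has one element
    the coefficient of the only t vanishes because f_{a,d} <> 0.

    That the quotients of R by one or two linear forms are domains is never
    stated as such: each is realized inside R itself, as the image of an
    endomorphism of R that solves the linear equations for some of the variables
    ([kill], [kill2]). *)

(** * Ideals given by generators *)

Section IdealGen.
Variables (A : comNzRingType) (S : A -> Prop).

Lemma mem_ideal_gen x : S x -> ideal_gen S x.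
Proof.
move=> Sx; exists [:: (1, x)]; last by rewrite big_seq1 mul1r.
by move=> p; rewrite inE => /eqP ->.
Qed.

Lemma ideal_gen0 : ideal_gen S 0.
Proof. by exists [::]; rewrite ?big_nil. Qed.

Lemma ideal_genD x y : ideal_gen S x -> ideal_gen S y -> ideal_gen S (x + y).
Proof.
move=> [s hs ->] [s' hs' ->]; exists (s ++ s'); last by rewrite big_cat.
by move=> p; rewrite mem_cat => /orP[/hs | /hs'].
Qed.

Lemma ideal_genM r x : ideal_gen S x -> ideal_gen S (r * x).
Proof.
move=> [s hs ->]; exists [seq (r * p.1, p.2) | p <- s].
  by move=> p /mapP[q /hs Sq ->].
by rewrite big_map mulr_sumr; apply: eq_bigr => p _; rewrite mulrA.
Qed.

End IdealGen.

Lemma ideal_gen_sub (A : comNzRingType) (S S' : A -> Prop) :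
  (forall x, S x -> ideal_gen S' x) ->
  forall x, ideal_gen S x -> ideal_gen S' x.
Proof.
move=> hS x [s hs ->]; elim: s hs => [|p s IHs] hs.
  by rewrite big_nil; apply: ideal_gen0.
rewrite big_cons; apply: ideal_genD; last first.
  by apply: IHs => q qs; apply: hs; rewrite inE qs orbT.
by apply/ideal_genM/hS/hs; rewrite mem_head.
Qed.

(** * Linear forms and elimination of variables *)

Lemma dhomog1E (A : comNzRingType) m (p : {mpoly A[m]}) :
  p \is 1.-homog -> p = \sum_i p@_U_(i) *: 'X_i.
Proof.
move=> p1; apply/mpolyP=> e; rewrite raddf_sum /=.
have [/mdeg1P[i /eqP ->] | e1] := boolP (mdeg e == 1%N).
  rewrite (bigD1 i) //= mcoeffZ mcoeffX eqxx mulr1 big1 ?addr0 // => j ji.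
  by rewrite mcoeffZ mcoeffX eq_mnm1 (negPf ji) mulr0.
rewrite (dhomog_nemf_coeff p1 e1) big1 // => i _.
rewrite mcoeffZ mcoeffX; case: eqP => [eU|_]; last by rewrite mulr0.
by rewrite -eU mdeg1 in e1.
Qed.

Lemma mpoly_closed_ind (A : comNzRingType) m (P : {mpoly A[m]} -> Prop) :
  (forall a, P a%:MP) -> (forall i, P 'X_i) ->
  (forall p q, P p -> P q -> P (p + q)) ->
  (forall p q, P p -> P q -> P (p * q)) -> forall p, P p.
Proof.
move=> PC PX PD PM; elim/mpolyind => [|a e p _ _ Pp]; first by rewrite -mpolyC0.
apply: PD Pp; rewrite -mul_mpolyC mpolyXE_id; apply: (PM) => //.
elim/big_rec: _ => [|i q _]; first by rewrite -mpolyC1.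
apply: (PM); elim: (e i) => [|d IHd]; first by rewrite expr0 -mpolyC1.
by rewrite exprS; apply: (PM).
Qed.

Section LinearForms.
Variables (K : fieldType) (k : nat).
Local Notation R := {mpoly K[k]}.
Implicit Types (l m : R) (F : R).

(** A variable for which the equation [l = 0] can be solved. *)
Definition pivot l : option 'I_k := [pick p | l@_U_(p) != 0].

(** The substitution solving [l = 0] for the pivot. A linear form without pivot
    is zero, and the substitution is then the identity, so that no case has to be
    excluded below. *)
Definition kill_vars l : k.-tuple R :=
  [tuple 'X_i - (if pivot l == Some i then (l@_U_(i))^-1 *: l else 0) | i < k].

(** For a linear form [l], an endomorphism of the polynomial ring whose kernel is
    the ideal of [l]: working with its values amounts to working in the quotient
    by [l], and the target is visibly a domain. *)
Definition kill l : R -> R := comp_mpoly (kill_vars l).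
HB.instance Definition _ l :=
  GRing.RMorphism.copy (kill l) (comp_mpoly (kill_vars l)).

Lemma killX l i :
  kill l 'X_i = 'X_i - (if pivot l == Some i then (l@_U_(i))^-1 *: l else 0).
Proof. by rewrite /kill comp_mpolyXU -tnth_nth tnth_mktuple. Qed.

(** The kernel of [kill l] is contained in the ideal of [l]: each variable is
    congruent to its image, hence so is each polynomial. *)
Lemma killE l F : exists r, F = kill l F + r * l.
Proof.
elim/mpoly_closed_ind: F => [a|i|p q [r er] [s es]|p q [r er] [s es]].
- by exists 0; rewrite /kill comp_mpolyC mul0r addr0.
- rewrite killX; case: eqP => _; last by exists 0; rewrite subr0 mul0r addr0.
  by exists ((l@_U_(i))^-1)%:MP; rewrite mul_mpolyC subrK.
- by exists (r + s); rewrite rmorphD mulrDl addrACA -er -es.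
- exists (r * q + kill l p * s); rewrite rmorphM /=.
  rewrite [kill l p](canRL (addrK _) (esym er)).
  by rewrite [kill l q](canRL (addrK _) (esym es)); ring.
Qed.

(** On linear forms the ideal membership of [killE] has a constant coefficient;
    this is what turns relations modulo [l] into linear dependencies over the
    field. *)
Lemma kill_linear l m : m \is 1.-homog -> exists a : K, kill l m = m - a *: l.
Proof.
move=> m1; exists (\sum_i if pivot l == Some i then m@_U_(i) / l@_U_(i) else 0).
rewrite scaler_suml {1 2}(dhomog1E m1) rmorph_sum -sumrB.
apply: eq_bigr => i _ /=.
rewrite /kill comp_mpolyZ -/(kill l _) killX scalerBr; congr (_ - _).
by case: eqP; rewrite ?scalerA // scaler0 scale0r.
Qed.

Lemma kill_self l : l \is 1.-homog -> kill l l = 0.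
Proof.
move=> l1; rewrite [X in kill _ X](dhomog1E l1) rmorph_sum /=.
under eq_bigr => i _ do rewrite /kill comp_mpolyZ -/(kill l _) killX scalerBr.
rewrite sumrB -(dhomog1E l1) /pivot; case: pickP => [p lp|l0].
  rewrite (bigD1 p) //= eqxx big1 => [|i ip]; last first.
    by rewrite (inj_eq Some_inj) eq_sym (negPf ip) scaler0.
  by rewrite scalerA mulfV // scale1r addr0 subrr.
rewrite big1 => [|i _]; last by rewrite scaler0.
rewrite subr0 (dhomog1E l1) big1 // => i _.
by rewrite (eqP (negbFE (l0 i))) scale0r.
Qed.

Lemma kill_dhomog l m :
  l \is 1.-homog -> m \is 1.-homog -> kill l m \is 1.-homog.
Proof.
by move=> l1 m1; have [a ->] := kill_linear l m1; rewrite rpredB ?rpredZ.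
Qed.

(** The quotient by [d] and [l], obtained by solving for [l] after [d]. *)
Definition kill2 d l : R -> R := kill (kill d l) \o kill d.
HB.instance Definition _ d l :=
  GRing.RMorphism.copy (kill2 d l) (kill (kill d l) \o kill d).

Lemma kill2_snd d l : d \is 1.-homog -> l \is 1.-homog -> kill2 d l l = 0.
Proof. by move=> d1 l1; rewrite /kill2 /= kill_self ?kill_dhomog. Qed.

Lemma kill2_eq0 d l F : kill2 d l F = 0 -> exists u v, F = u * l + v * d.
Proof.
move=> F0; have [r er] := killE d F; have [s es] := killE (kill d l) (kill d F).
have [q eq] := killE d l; exists s, (r - s * q).
by rewrite er es -[kill _ (kill _ F)]/(kill2 d l F) F0 {2}eq; ring.
Qed.

Lemma kill2_linear d l m : l \is 1.-homog -> m \is 1.-homog -> d \is 1.-homog ->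
  kill2 d l m = 0 -> exists a b : K, m = a *: l + b *: d.
Proof.
move=> l1 m1 d1; rewrite /kill2 /=.
have [x ->] := kill_linear (kill d l) (kill_dhomog d1 m1).
have [y ->] := kill_linear d m1; have [z ->] := kill_linear d l1 => e0.
exists x, (y - x * z); rewrite scalerBl -scalerA addrCA -scalerBr.
by apply/eqP; rewrite -subr_eq0 opprD addrA e0.
Qed.

End LinearForms.

(** * Variables indexed by unordered pairs *)

Section Setting.
Variables (K : fieldType) (k n : nat) (ell : 'I_n -> {mpoly K[k]}).
Local Notation R := {mpoly K[k]}.
Local Notation T := (Tring K k n).

(** Extended by zero to [j <= i], so that [tsym] can be defined without case
    analysis. *)
Definition tmono (i j : 'I_n) : T :=
  if insub (i, j) is Some p then 'X_(enum_rank (p : opair n)) else 0.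

Definition tsym (i j : 'I_n) : T := tmono i j + tmono j i.

Lemma tsymC i j : tsym i j = tsym j i.
Proof. exact: addrC. Qed.

Lemma tmono_ge (i j : 'I_n) : (j <= i)%N -> tmono i j = 0.
Proof. by move=> ji; rewrite /tmono insubN //= -leqNgt. Qed.

Lemma tsymE (i j : 'I_n) (h : (i < j)%N) : tsym i j = tvar K k h.
Proof.
rewrite /tsym (tmono_ge (ltnW h)) addr0 /tmono /tvar insubT.
by congr 'X_(enum_rank _); apply: val_inj.
Qed.

Lemma tsymii i : tsym i i = 0.
Proof. by rewrite /tsym tmono_ge ?addr0. Qed.

Lemma mpolyX_tsym (v : 'I_#|{: opair n}|) :
  'X_v = tsym (val (enum_val v)).1 (val (enum_val v)).2 :> T.
Proof.
rewrite (tsymE (valP (enum_val v))) /tvar -[v in LHS]enum_valK.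
by congr 'X_(enum_rank _); apply: val_inj => /=; case: (\val _).
Qed.

(** * Values in the Rees algebra *)

Lemma prod_butC i j : prod_but ell i j = prod_but ell j i.
Proof. by apply: eq_bigl => m; rewrite andbC. Qed.

Lemma prod_but_mul i j : i != j ->
  ell i * prod_but ell i j = \prod_(m < n | m != j) ell m.
Proof.
move=> ij; rewrite [RHS](bigD1 i) //=; congr (_ * _).
by apply: eq_bigl => m; rewrite andbC.
Qed.

Lemma prod_butD1 i j d : d != i -> d != j ->
  prod_but ell i j = ell d * \prod_(m < n | m \notin [:: i; j; d]) ell m.
Proof.
move=> di dj; rewrite /prod_but (bigD1 d) ?di //=; congr (_ * _).
by apply: eq_bigl => m; rewrite !inE !negb_or andbA.
Qed.

HB.instance Definition _ := GRing.RMorphism.copy (rees_map ell)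
  (mmap (@polyC _)
     (fun v => let p := val (enum_val v) in prod_but ell p.1 p.2 *: 'X)).

Lemma rees_mapZ r F : rees_map ell (r *: F) = r *: rees_map ell F.
Proof. by rewrite /rees_map mmapZ mul_polyC. Qed.

Lemma rees_tvar (i j : 'I_n) (h : (i < j)%N) :
  rees_map ell (tvar K k h) = prod_but ell i j *: 'X.
Proof. by rewrite /rees_map /tvar mmapX mmap1U enum_rankK. Qed.

Lemma rees_tsym i j :
  i != j -> rees_map ell (tsym i j) = prod_but ell i j *: 'X.
Proof.
case: (ltngtP i j) => [h _|h _|/val_inj -> /eqP //].
  by rewrite tsymE rees_tvar.
by rewrite tsymC tsymE rees_tvar prod_butC.
Qed.

Lemma rees_slide a b d : a != b -> d != b ->
  rees_map ell (ell a *: tsym a b - ell d *: tsym d b) = 0.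
Proof.
move=> ab db; rewrite rmorphB /= !rees_mapZ !rees_tsym // !scalerA.
by rewrite !prod_but_mul // subrr.
Qed.

Lemma rees_circuit (i1 i2 i3 : 'I_n) (c : 'I_n -> K) :
    i1 != i2 -> i1 != i3 -> i2 != i3 ->
  c i1 *: ell i1 + c i2 *: ell i2 + c i3 *: ell i3 = 0 ->
  rees_map ell ((c i1)%:MP *: tsym i2 i3 + (c i2)%:MP *: tsym i1 i3
                 + (c i3)%:MP *: tsym i1 i2) = 0.
Proof.
move=> n12 n13 n23 dep; rewrite !rmorphD /= !rees_mapZ !rees_tsym //.
rewrite !scalerA -!scalerDl.
rewrite (prod_butD1 n12 n13) (@prod_butD1 i1 i3 i2) 1?[i2 == i1]eq_sym //.
rewrite (@prod_butD1 i1 i2 i3) 1?[i3 == _]eq_sym // !mulrA !mul_mpolyC.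
pose P m := m \notin [:: i2; i3; i1].
rewrite [X in _ + _ * X + _](eq_bigl P) => [|m]; last first.
  by rewrite /P !inE; do 3!case: (m == _).
rewrite [X in _ + _ + _ * X](eq_bigl P) => [|m]; last first.
  by rewrite /P !inE; do 3!case: (m == _).
by rewrite -!mulrDl dep mul0r scale0r.
Qed.

(** * Symmetric forms of the generators *)

Lemma circuit_swap12 a b d : circuit ell a b d -> circuit ell b a d.
Proof.
by move=> [c [ca cb cd e]]; exists c; split; rewrite // [X in X + _]addrC.
Qed.

Lemma circuit_swap23 a b d : circuit ell a b d -> circuit ell a d b.
Proof. by move=> [c [ca cb cd e]]; exists c; split; rewrite // addrAC. Qed.

Lemma sorted_triple_ind (P : 'I_n -> 'I_n -> 'I_n -> Prop) :
    (forall a b d, P a b d -> P b a d) -> (forall a b d, P a b d -> P a d b) ->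
    (forall a b d : 'I_n, (a < b)%N -> (b < d)%N -> P a b d) ->
  forall a b d, a != b -> b != d -> a != d -> P a b d.
Proof.
move=> P12 P23 Plt a b d.
case: (ltngtP a b) => [ab _|ba _|/val_inj -> /eqP //];
case: (ltngtP b d) => [bd _|db _|/val_inj -> /eqP //];
case: (ltngtP a d) => [ad _|da _|/val_inj -> /eqP //].
- exact: Plt.
- by have := ltn_trans (ltn_trans ab bd) da; rewrite ltnn.
- exact/P23/Plt.
- exact/P23/P12/Plt.
- exact/P12/Plt.
- exact/P12/P23/Plt.
- by have := ltn_trans (ltn_trans ad db) ba; rewrite ltnn.
- exact/P12/P23/P12/Plt.
Qed.

Variable c : 'I_n -> 'I_n -> 'I_n -> 'I_n -> K.
Local Notation J := (ideal_gen (generator ell c)).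

(** The families A, B, C are the cases where the common index [b] is
    between, above or below the other two; exchanging [a] and [d] only changes the
    sign. *)
Lemma slide_mem a b d : a != b -> d != b -> a != d ->
  J (ell a *: tsym a b - ell d *: tsym d b).
Proof.
move=> ab db ad.
wlog {ad} ad : a d ab db / (a < d)%N.
  move=> W; case: (ltngtP a d) ad => [h _|h _|/val_inj -> /eqP //].
    exact: W.
  by rewrite -opprB -mulN1r; apply/ideal_genM/W.
case: (ltngtP a b) ab => [ab _|ba _|/val_inj -> /eqP //].
  case: (ltngtP d b) db => [db _|bd _|/val_inj -> /eqP //].
    by rewrite !tsymE; apply/mem_ideal_gen/GenB.
  by rewrite (tsymC d) !tsymE; apply/mem_ideal_gen/GenA.
have bd := ltn_trans ba ad.
by rewrite !(tsymC _ b) !tsymE; apply/mem_ideal_gen/GenC.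
Qed.

Hypothesis ell_homog : forall i, ell i \is 1.-homog.
Hypothesis ell_nonprop : forall i j, i != j -> ~ proportional (ell i) (ell j).
Hypothesis c_dep : forall i1 i2 i3 : 'I_n, (i1 < i2)%N -> (i2 < i3)%N ->
  circuit ell i1 i2 i3 -> dependency3 ell i1 i2 i3 (c i1 i2 i3).

(** The coefficients are left existential because the chosen dependencies belong
    to increasing triples, while the statement has to be stable under
    permutations to be reduced to that case. *)
Lemma circuit_mem a b d : a != b -> b != d -> a != d -> circuit ell a b d ->
  exists x y z : K, [/\ x != 0, y != 0, z != 0
    & J (x%:MP *: tsym b d + y%:MP *: tsym a d + z%:MP *: tsym a b)].
Proof.
move: a b d; apply: sorted_triple_ind => [a b d W|a b d W|a b d ab bd cir].
- move/circuit_swap12/W => [x [y [z [x0 y0 z0 h]]]]; exists y, x, z; split=> //.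
  by rewrite (tsymC b a) [X in X + _]addrC.
- move/circuit_swap23/W => [x [y [z [x0 y0 z0 h]]]]; exists x, z, y; split=> //.
  by rewrite (tsymC d b) addrAC.
have [ca cb cd _] := c_dep ab bd cir.
exists (c a b d a), (c a b d b), (c a b d d); split=> //.
have ad := ltn_trans ab bd.
by rewrite !tsymE; apply/mem_ideal_gen/GenL.
Qed.

Lemma generator_rees F :
  generator ell c F -> F \is 1.-homog /\ rees_map ell F = 0.
Proof.
have t1 (i j : 'I_n) (h : (i < j)%N) : tvar K k h \is 1.-homog.
  by rewrite dhomogX; apply/eqP/mdeg1.
have neq (i j : 'I_n) : (i < j)%N -> i != j by move=> ij; rewrite neq_ltn ij.
case=> [i1 i2 i3 h12 h23 h13 cir|a b d ab bd|a b d ab bd ad|a b d ab bd ad].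
- split; first by rewrite !rpredD ?rpredZ ?t1.
  have [_ _ _ dep] := c_dep h12 h23 cir.
  by rewrite -!tsymE; apply: rees_circuit; rewrite ?neq.
- split; first by rewrite rpredB ?rpredZ ?t1.
  rewrite -!tsymE (tsymC b).
  by apply: rees_slide; [|rewrite eq_sym]; exact: neq.
- split; first by rewrite rpredB ?rpredZ ?t1.
  by rewrite -!tsymE; apply: rees_slide; exact: neq.
- split; first by rewrite rpredB ?rpredZ ?t1.
  by rewrite -!tsymE !(tsymC a); apply: rees_slide; rewrite eq_sym; exact: neq.
Qed.

Lemma ideal_rees F : J F -> rees_map ell F = 0.
Proof.
move=> [s hs ->]; rewrite rmorph_sum big_seq big1 // => p /hs.
by move=> /generator_rees[_ p0]; rewrite rmorphM /= p0 mulr0.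
Qed.

Lemma ideal_genZ r F : J F -> J (r *: F).
Proof. by rewrite -mul_mpolyC; apply: ideal_genM. Qed.

(** * Combinations of the variables indexed by a set *)

Definition span_mod (S : {set 'I_n}) (F : T) : Prop :=
  exists h : 'I_n -> 'I_n -> R,
    J (F - \sum_(i in S) \sum_(j in S) h i j *: tsym i j).

Section SpanMod.
Variable S : {set 'I_n}.

Lemma span_mod_ideal F : J F -> span_mod S F.
Proof.
exists (fun _ _ => 0); rewrite big1 ?subr0 // => i _.
by rewrite big1 // => j _; rewrite scale0r.
Qed.

Lemma span_modD F G : span_mod S F -> span_mod S G -> span_mod S (F + G).
Proof.
move=> [h hF] [h' hG]; exists (fun i j => h i j + h' i j).
rewrite (eq_bigr _ (fun i _ => eq_bigr _ (fun j _ => scalerDl _ _ _))).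
rewrite (eq_bigr _ (fun i _ => big_split _ _ _ _ _)) big_split /= opprD addrACA.
exact: ideal_genD.
Qed.

Lemma span_modZ r F : span_mod S F -> span_mod S (r *: F).
Proof.
move=> [h hF]; exists (fun i j => r * h i j).
rewrite (eq_bigr (fun i => r *: \sum_(j in S) h i j *: tsym i j)) => [|i _].
  by rewrite -scaler_sumr -scalerBr; apply: ideal_genZ.
by rewrite scaler_sumr; apply: eq_bigr => j _; rewrite scalerA.
Qed.

Lemma span_modB F G : span_mod S F -> span_mod S G -> span_mod S (F - G).
Proof. by move=> hF hG; rewrite -scaleN1r; apply/span_modD/span_modZ. Qed.

Lemma span_mod_sum (I : finType) (P : pred I) (F : I -> T) :
  (forall i, P i -> span_mod S (F i)) -> span_mod S (\sum_(i | P i) F i).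
Proof.
move=> hF; elim/big_rec: _ => [|i x /hF]; last exact: span_modD.
exact/span_mod_ideal/ideal_gen0.
Qed.

Lemma span_mod_tsym a b : a \in S -> b \in S -> span_mod S (tsym a b).
Proof.
move=> aS bS; exists (fun i j => ((i == a) && (j == b))%:R).
rewrite (bigD1 a) //= (bigD1 b) //= !eqxx scale1r.
rewrite big1 => [|j /andP[_ /negPf ->]]; last by rewrite scale0r.
rewrite big1 => [|i /andP[_ /negPf ->]]; last first.
  by rewrite big1 // => j _; rewrite scale0r.
by rewrite !addr0 subrr; apply: ideal_gen0.
Qed.

Lemma span_mod_split d F : d \in S -> span_mod S F ->
  exists u : 'I_n -> R,
    span_mod (S :\ d) (F - \sum_(i in S :\ d) u i *: tsym i d).
Proof.
move=> dS [h hF]; exists (fun i => h i d + h d i), h; move: hF; congr (J _).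
rewrite (big_setD1 d) //= (big_setD1 d) //= tsymii scaler0 add0r.
under [X in _ - (_ + X)]eq_bigr => i _ do rewrite (big_setD1 d) //=.
rewrite big_split /= -addrA -opprD addrA -big_split /=; congr (_ - (_ + _)).
by apply: eq_bigr => i _; rewrite scalerDl addrC (tsymC d).
Qed.

(** The product [prod_but ell i j] contains every form other than the i-th and the
    j-th, in particular the d-th if [d] is outside [S]. *)
Lemma span_mod_rees d F : d \notin S -> span_mod S F ->
  exists r, rees_map ell F = (r * ell d) *: 'X.
Proof.
move=> dS [h /ideal_rees/eqP]; rewrite rmorphB subr_eq0 => /eqP /= ->.
pose Q G := exists r, G = (r * ell d) *: 'X.
have Q0 : Q 0 by exists 0; rewrite mul0r scale0r.
have QD x y : Q x -> Q y -> Q (x + y).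
  by move=> [r ->] [s ->]; exists (r + s); rewrite mulrDl scalerDl.
rewrite rmorph_sum; apply: (big_ind Q) => // i iS.
rewrite rmorph_sum; apply: (big_ind Q) => // j jS; rewrite /= rees_mapZ.
have [->|ij] := eqVneq i j; first by rewrite tsymii rmorph0 scaler0.
rewrite rees_tsym // (@prod_butD1 i j d); last 2 first.
- by apply: contraNneq dS => ->.
- by apply: contraNneq dS => ->.
by rewrite scalerA mulrCA mulrC; eexists.
Qed.

Lemma span_mod_small F : (#|S| <= 1)%N -> span_mod S F -> J F.
Proof.
move=> /card_le1_eqP S1 [h]; rewrite big1 ?subr0 // => i iS.
by rewrite big1 // => j jS; rewrite (S1 i j) // tsymii scaler0.
Qed.

Hypothesis S_gt1 : (1 < #|S|)%N.
Variable d : 'I_n.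
Hypothesis dS : d \notin S.

Let neqd i : i \in S -> i != d.
Proof. by move=> iS; apply: contraNneq dS => <-. Qed.

(** A coefficient [ell d] allows to trade the index [d] for an index [b] of [S];
    [b] must differ from [i], which is why [S] needs two elements. *)
Lemma span_mod_slide i : i \in S -> span_mod S (ell d *: tsym i d).
Proof.
move=> iS; have [b] : exists b, b \in S :\ i.
  by apply/set0Pn; rewrite -card_gt0; move: S_gt1; rewrite (cardsD1 i) iS.
rewrite !inE => /andP[bi bS].
rewrite -[_ *: _](subrK (ell b *: tsym b i)); apply: span_modD.
  rewrite (tsymC i d).
  by apply/span_mod_ideal/slide_mem => //; rewrite eq_sym neqd.
exact/span_modZ/span_mod_tsym.
Qed.

(** Modulo [ell d] the forms of a and b are proportional; the relation L of the
    circuit lifts this proportionality. *)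
Lemma span_mod_circuit a b :
    a \in S -> b \in S -> a != b -> circuit ell a b d ->
  exists r, span_mod S (tsym a d - r *: tsym b d).
Proof.
move=> aS bS ab cir.
have [x [y [z [_ y0 _ h]]]] := circuit_mem ab (neqd bS) (neqd aS) cir.
exists (- (x / y)%:MP).
pose G := (x%:MP *: tsym b d + y%:MP *: tsym a d + z%:MP *: tsym a b) : T.
have -> : tsym a d - (- (x / y)%:MP) *: tsym b d =
    (y^-1)%:MP *: G - (z / y)%:MP *: tsym a b.
  rewrite /G; move: (tsym b d) (tsym a d) (tsym a b) => t1 t2 t3.
  rewrite !scalerDr !scalerA -!mpolyCM mulVf // mpolyC1 !scale1r.
  by rewrite [_ * z]mulrC addrK scaleNr opprK addrC [_ * x]mulrC.
apply: span_modB; first exact/span_mod_ideal/ideal_genZ.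
exact/span_modZ/span_mod_tsym.
Qed.

End SpanMod.
(** * Elimination of one index *)

Lemma kill_ell_neq0 d j : j != d -> kill (ell d) (ell j) != 0.
Proof.
move=> jd; apply/eqP => e0; have [a] := kill_linear (ell d) (ell_homog j).
rewrite e0 => /esym/eqP; rewrite subr_eq0 => /eqP ej.
by apply: (ell_nonprop jd); exists a; left.
Qed.

Lemma ell_neq0 j d : j != d -> ell j != 0.
Proof. by move/kill_ell_neq0; apply: contraNneq => ->; rewrite rmorph0. Qed.

(** A nontrivial dependency of three pairwise non-proportional forms has three
    nonzero coefficients. *)
Lemma kill2_circuit a b d : a != b -> a != d -> b != d ->
  kill2 (ell d) (ell a) (ell b) = 0 -> circuit ell a b d.
Proof.
move=> ab ad bd /kill2_linear[] // x [y eb].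
have x0 : x != 0.
  apply/eqP => x0; apply: (ell_nonprop bd); exists y; left.
  by rewrite eb x0 scale0r add0r.
have y0 : y != 0.
  apply/eqP => y0; apply: (ell_nonprop ab); exists x; right.
  by rewrite eb y0 scale0r addr0.
exists (fun m => if m == a then x else if m == b then -1 else y).
rewrite /dependency3 eqxx [b == a]eq_sym (negPf ab) eqxx ![d == _]eq_sym.
rewrite (negPf ad) (negPf bd); split; rewrite // ?oppr_eq0 ?oner_eq0 //.
by rewrite scaleN1r addrAC -eb subrr.
Qed.

Section Independent.
Variables (d : 'I_n) (Q : {set 'I_n}).
Hypothesis dQ : d \notin Q.
Hypothesis indepQ :
  {in Q &, forall a b, a != b -> kill2 (ell d) (ell a) (ell b) != 0}.

Let neqd q : q \in Q -> q != d.
Proof. by move=> qQ; apply: contraNneq dQ => <-. Qed.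

Lemma prod_but_set q : q \in Q -> prod_but ell q d =
  (\prod_(m | (m \notin Q) && (m != d)) ell m) * \prod_(m in Q :\ q) ell m.
Proof.
move=> qQ; rewrite /prod_but (bigID (mem Q)) /= mulrC; congr (_ * _).
  apply: eq_bigl => m; have [->|] := eqVneq m q; first by rewrite qQ.
  by rewrite andbC.
apply: eq_bigl => m; rewrite !inE.
have [mQ|] := boolP (m \in Q); last by rewrite !andbF.
by rewrite neqd ?andbT.
Qed.

(** The syzygies of the products of all but one of pairwise coprime elements are
    generated by the differences of [ell q] times a basis vector; here this is
    carried out modulo [ell d]. *)
Lemma independent_syzygy (u : 'I_n -> R) r :
    \sum_(q in Q) u q * prod_but ell q d = r * ell d ->
  exists a v : 'I_n -> R, exists w : R,
    (forall q, q \in Q -> u q = a q * ell q + v q * ell d)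
    /\ \sum_(q in Q) a q = w * ell d.
Proof.
set D := \prod_(m | (m \notin Q) && (m != d)) ell m.
(* Cancel the common factor D modulo [ell d]. *)
have kd0 : kill (ell d) (ell d) = 0 by exact: kill_self.
pose U := \sum_(q in Q) u q * \prod_(m in Q :\ q) ell m.
move=> eu; have ku : kill (ell d) U = 0.
  apply/eqP; have /eqP : kill (ell d) (D * U) = 0.
    rewrite mulr_sumr (eq_bigr (fun q => u q * prod_but ell q d)) => [|q qQ].
      by rewrite eu rmorphM /= kd0 mulr0.
    by rewrite prod_but_set // mulrCA.
  rewrite rmorphM mulf_eq0 /= => /orP[|//].
  rewrite rmorph_prod => /prodf_eq0[m /andP[_ md]].
  by rewrite (negPf (kill_ell_neq0 md)).
(* Modulo [ell d] and [ell q] only the summand of index q survives. *)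
have : forall q, exists av : R * R,
    q \in Q -> u q = av.1 * ell q + av.2 * ell d.
  move=> q; have [qQ|] := boolP (q \in Q); last by exists (0, 0).
  suff /kill2_eq0[a [v ->]] : kill2 (ell d) (ell q) (u q) = 0 by exists (a, v).
  have /(congr1 (kill (kill (ell d) (ell q)))) := ku.
  rewrite rmorph0 -[kill _ (kill _ _)]/(kill2 (ell d) (ell q) _).
  rewrite rmorph_sum (bigD1 q) //=.
  rewrite [X in _ + X]big1 => [|i /andP[iQ iq]]; last first.
    rewrite rmorphM rmorph_prod /= (bigD1 q) /=; last by rewrite !inE eq_sym iq.
    by rewrite kill2_snd // mul0r mulr0.
  rewrite addr0 rmorphM => /eqP; rewrite mulf_eq0 => /orP[/eqP //|].
  rewrite rmorph_prod => /prodf_eq0[m]; rewrite !inE => /andP[mq mQ].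
  by rewrite (negPf (indepQ qQ mQ _)) // eq_sym.
move/fin_all_exists => [av hav].
(* Substituting back, the products become the full product over Q. *)
have /eqP : kill (ell d) ((\sum_(q in Q) (av q).1) * \prod_(m in Q) ell m) = 0.
  rewrite -[RHS]ku mulr_suml !rmorph_sum; apply: eq_bigr => q qQ /=.
  rewrite (hav q qQ) (big_setD1 q) //= mulrA mulrDl !rmorphD !rmorphM /= kd0.
  by rewrite mulr0 mul0r addr0.
rewrite rmorphM mulf_eq0 => /orP[/eqP ka|]; last first.
  rewrite rmorph_prod => /prodf_eq0[m mQ].
  by rewrite (negPf (kill_ell_neq0 (neqd mQ))).
have [w ew] := killE (ell d) (\sum_(q in Q) (av q).1).
exists (fun q => (av q).1), (fun q => (av q).2), w; split=> //.
by rewrite ew ka add0r.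
Qed.

(** Once the coefficients have the form given by [independent_syzygy], the slide
    relations suffice. *)
Lemma span_mod_independent (S : {set 'I_n}) (u : 'I_n -> R) F :
    (1 < #|S|)%N -> d \notin S -> Q \subset S -> rees_map ell F = 0 ->
    span_mod S (F - \sum_(q in Q) u q *: tsym q d) -> span_mod S F.
Proof.
move=> S1 dS /subsetP QS F0 hF.
have slide q : q \in Q -> span_mod S (ell d *: tsym q d).
  by move/QS; apply: span_mod_slide.
have [r] := span_mod_rees dS hF.
rewrite rmorphB /= F0 rmorph_sum /= sub0r => er.
have eu : \sum_(q in Q) u q * prod_but ell q d = (- r) * ell d.
  have /(congr1 (fun p : {poly R} => p`_1)) := er.
  under eq_bigr => q qQ do rewrite rees_mapZ rees_tsym ?neqd // scalerA.
  rewrite -scaler_suml coefN !coefZ coefX !mulr1 mulNr => <-.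
  by rewrite opprK.
have [a [v [w [eav ew]]]] := independent_syzygy eu.
have [Q0|[q0 q0Q]] := set_0Vmem Q.
  by move: hF; rewrite Q0 big_set0 subr0.
rewrite -[F](subrK (\sum_(q in Q) u q *: tsym q d)); apply: (span_modD hF).
have -> : \sum_(q in Q) u q *: tsym q d =
    \sum_(q in Q) (v q *: (ell d *: tsym q d)
                   + a q *: (ell q *: tsym q d - ell q0 *: tsym q0 d))
    + (w * ell q0) *: (ell d *: tsym q0 d).
  rewrite scalerA mulrAC -ew mulr_suml scaler_suml -big_split /=.
  apply: eq_bigr => q qQ; rewrite (eav q qQ) scalerBr !scalerA scalerDl.
  by rewrite -[RHS]addrA subrK addrC.
apply: span_modD; last exact/span_modZ/slide.
apply: span_mod_sum => q qQ; apply: span_modD; first exact/span_modZ/slide.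
apply/span_modZ/span_mod_ideal; have [->|qq0] := eqVneq q q0.
  by rewrite subrr; apply: ideal_gen0.
by apply: slide_mem => //; apply: neqd.
Qed.

End Independent.

(** Each circuit through [d] with two indices in [Q] removes one of them, without
    changing the set [S]; when there is none left, the independent case applies. *)
Lemma span_mod_reduce (S Q : {set 'I_n}) d (u : 'I_n -> R) F :
    (1 < #|S|)%N -> d \notin S -> Q \subset S -> rees_map ell F = 0 ->
    span_mod S (F - \sum_(q in Q) u q *: tsym q d) -> span_mod S F.
Proof.
move=> S1 dS QS F0; have [m] := ubnP #|Q|.
elim: m => // m IHm in Q u QS *; rewrite ltnS => Qm hF.
have neqd i : i \in S -> i != d by move=> iS; apply: contraNneq dS => <-.
have [/existsP[a /existsP[b]]|] := boolP [exists a, exists b,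
    [&& a \in Q, b \in Q, a != b & kill2 (ell d) (ell a) (ell b) == 0]].
  move=> /and4P[aQ bQ ab /eqP kab].
  have [aS bS] := (subsetP QS a aQ, subsetP QS b bQ).
  have cir := kill2_circuit ab (neqd a aS) (neqd b bS) kab.
  have [r hr] := span_mod_circuit dS aS bS ab cir.
  apply: (IHm (Q :\ a) (fun q => u q + (if q == b then u a * r else 0))).
  - by apply: subset_trans QS; apply: subD1set.
  - by move: Qm; rewrite (cardsD1 a) aQ.
  have bQa : b \in Q :\ a by rewrite !inE eq_sym ab.
  have -> : F - \sum_(q in Q :\ a)
                   (u q + (if q == b then u a * r else 0)) *: tsym q d
      = F - \sum_(q in Q) u q *: tsym q d + u a *: (tsym a d - r *: tsym b d).
    have sum_b : \sum_(q in Q :\ a) (if q == b then u a * r else 0) *: tsym q d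
        = (u a * r) *: tsym b d.
      rewrite (bigD1 b) //= eqxx big1 ?addr0 // => q qb.
      by case/andP: qb => _ /negPf ->; rewrite scale0r.
    rewrite (big_setD1 a aQ) (eq_bigr _ (fun q _ => scalerDl _ _ _)).
    rewrite big_split /= sum_b.
    rewrite scalerBr scalerA !opprD !addrA; congr (_ - _).
    by rewrite -!addrA; congr (_ + _); rewrite addrCA addNr addr0.
  exact/(span_modD hF)/span_modZ.
move/existsPn => indep; apply: (span_mod_independent _ _ S1 dS QS F0 hF).
  by apply: contra dS; apply: (subsetP QS).
move=> a b aQ bQ ab; have /existsPn/(_ b) := indep a.
by rewrite aQ bQ ab.
Qed.

Lemma span_mod_syzygy (S : {set 'I_n}) F :
  rees_map ell F = 0 -> span_mod S F -> J F.
Proof.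
move=> F0; have [m] := ubnP #|S|.
elim: m => // m IHm in S *; rewrite ltnS => Sm hF.
have [S1|S1] := leqP #|S| 1; first exact: span_mod_small hF.
have [d dS] : exists d, d \in S by apply/set0Pn; rewrite -card_gt0 ltnW.
have [u hu] := span_mod_split dS hF.
have d' : d \notin S :\ d by rewrite !inE eqxx.
have Sd : #|S| = #|S :\ d|.+1 by rewrite (cardsD1 d) dS.
have [S2|S2] := ltnP 1 #|S :\ d|.
  apply: (IHm (S :\ d)); first by rewrite -Sd.
  exact: span_mod_reduce hu.
(* With a single other index a there is nothing to trade [d] for, but then only
   the multiple u a of t_{a,d} is left. *)
have /cards1P[a Sa] : #|S :\ d| == 1%N by rewrite eqn_leq S2 -ltnS -Sd.
have ad : a != d by move: (set11 a); rewrite -Sa !inE => /andP[].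
have := span_mod_small S2 hu; rewrite Sa big_set1 => hJ.
have /eqP := ideal_rees hJ.
rewrite rmorphB /= F0 sub0r oppr_eq0 rees_mapZ rees_tsym //.
rewrite scalerA scale_poly_eq0 polyX_eq0 orbF mulf_eq0 => /orP[/eqP ua|].
  by move: hJ; rewrite ua scale0r subr0.
by move=> /prodf_eq0[j /andP[ja _]]; rewrite (negPf (ell_neq0 ja)).
Qed.

Lemma sym_ideal_generated F : sym_ideal ell F <-> J F.
Proof.
split; apply: ideal_gen_sub => G; last first.
  by move=> /generator_rees hG; apply: mem_ideal_gen.
move=> [G1 G0]; apply: (@span_mod_syzygy setT G G0).
rewrite (dhomog1E G1); apply: span_mod_sum => v _.
by rewrite mpolyX_tsym; apply/span_modZ/span_mod_tsym; rewrite inE.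
Qed.

End Setting.

Theorem proposition3p6 (K : fieldType) (k n : nat)
    (ell : 'I_n -> {mpoly K[k]}) (c : 'I_n -> 'I_n -> 'I_n -> 'I_n -> K) :
  [pchar K] =i pred0 ->
  (2 <= n)%N ->
  (forall i, ell i \is 1.-homog) ->
  (forall i j, i != j -> ~ proportional (ell i) (ell j)) ->
  (forall i1 i2 i3 : 'I_n, (i1 < i2)%N -> (i2 < i3)%N ->
     circuit ell i1 i2 i3 -> dependency3 ell i1 i2 i3 (c i1 i2 i3)) ->
  forall F : Tring K k n,
    sym_ideal ell F <-> ideal_gen (generator ell c) F.
Proof. by move=> _ _ ell1 nprop dep F; apply: sym_ideal_generated. Qed.
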